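(* Let the Standing Assumption hold, and assume in addition that $f(z)=J(z)\eta(z)$ for all $z\in\mathbb R^n$, for some (unknown) map $J\colon\mathbb R^n\to\mathbb R^{n\times n}$ with $J(z)=-J(z)^{\mathsf T}$. Then: 1. There exists $P\colon\mathbb R^n\to\mathbb R^{n\times n}$ such that $P(z)\eta(z)=0$ and $M(z)_{\mathsf H}+P(z)_{\mathsf H}=0$ for all $z\in\mathbb R^n$. 2. Let $z\in\mathbb R^n$ satisfy $\eta(z)\ne0$ and $\eta_i(z)\neq 0$ for $i=2,\dots,n-1$. Then there is exactly one matrix $P\in\mathbb R^{n\times n}$ such that: - $P\eta(z)=0$; - $P_{\mathsf H}=-M(z)_{\mathsf H}$; - $P_{\mathsf S}$ is tridiagonal. Equivalently, the entries $p=(p_1,\dots,p_{n-1})$ of the superdiagonal of $P_{\mathsf S}$ form the unique solution of $T(\eta(z))\,p=M(z)_{\mathsf H}\,\eta(z)$. Here $T(\eta)\in\mathbb R^{n\times(n-1)}$ is the matrix whose $k$-th column has entry $\eta_{k+1}$ in row $k$, entry $-\eta_k$ in row $k+1$, and zeros elsewhere.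
   Context: Setting. Let $n,m$ be positive integers. Let $\mathcal H\colon\mathbb R^n\to\mathbb R$ be continuously differentiable with $\mathcal H\ge 0$, and set $\eta\coloneq\nabla\mathcal H\colon\mathbb R^n\to\mathbb R^n$. Let $f\colon\mathbb R^n\to\mathbb R^n$ and $B\colon\mathbb R^n\to\mathbb R^{n\times m}$. Consider the system $\dot z = f(z)+B(z)u$, $y=B(z)^{\mathsf T}\eta(z)$. Notation. For $A\in\mathbb R^{n\times n}$: $A_{\mathsf H}\coloneq\tfrac12(A+A^{\mathsf T})$ and $A_{\mathsf S}\coloneq\tfrac12(A-A^{\mathsf T})$. Property (P): there exist $p\in\mathbb N$ and $\ell\colon\mathbb R^n\to\mathbb R^p$ with $\eta(z)^{\mathsf T}f(z)=-\ell(z)^{\mathsf T}\ell(z)$ for all $z$. Standing Assumption: property (P) holds; $f,\eta$ are $C^1$; $\eta\colon\mathbb R^n\to\mathbb R^n$ is bijective; $f(\eta^{-1}(0))=0$; and $D\eta(z)$ is invertible for all $z\in\mathbb R^n$. Definition of $M$. Under the Standing Assumption $\eta^{-1}$ is $C^1$, and $M(z)\coloneq\int_0^1 D(f\circ\eta^{-1})(s\,\eta(z))\,\mathrm ds=\int_0^1 Df(\zeta_s)D\eta(\zeta_s)^{-1}\,\mathrm ds$, where $\zeta_s\coloneq\eta^{-1}(s\eta(z))$. This satisfies $f(z)=M(z)\eta(z)$ for all $z$. *)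

(* Defs.v *)
From HB Require Import structures.
From mathcomp Require Import all_boot all_order all_algebra.
From mathcomp Require Import all_classical all_reals all_analysis.
Set Implicit Arguments. Unset Strict Implicit. Unset Printing Implicit Defensive.
Import Order.TTheory GRing.Theory Num.Theory.
Import numFieldNormedType.Exports.
Local Open Scope ring_scope.
Local Open Scope classical_set_scope.

Section Defs.
Variable R : realType.

Definition symPart n (A : 'M[R]_n) : 'M[R]_n := 2^-1 *: (A + A^T).
Definition skewPart n (A : 'M[R]_n) : 'M[R]_n := 2^-1 *: (A - A^T).

Definition ebasis n (j : 'I_n) : 'cV[R]_n := delta_mx j 0.

Definition jac n m (g : 'cV[R]_n -> 'cV[R]_m) (x : 'cV[R]_n) : 'M[R]_(m, n) :=
  \matrix_(i, j) ('D_(ebasis j) g x) i 0.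

(* g is continuously differentiable: differentiable everywhere, with all
   partial derivatives continuous (equivalent to C^1 in finite dimension) *)
Definition C1 n m (g : 'cV[R]_n -> 'cV[R]_m) : Prop :=
  (forall x, differentiable g x) /\
  (forall j : 'I_n, continuous (fun x => 'D_(ebasis j) g x)).

Definition C1scal n (g : 'cV[R]_n -> R) : Prop :=
  (forall x, differentiable g x) /\
  (forall j : 'I_n, continuous (fun x => 'D_(ebasis j) g x)).

Definition is_gradient n (H : 'cV[R]_n -> R) (eta : 'cV[R]_n -> 'cV[R]_n) : Prop :=
  forall z, differentiable H z /\
    forall v : 'cV[R]_n, 'D_v H z = ((eta z)^T *m v) 0 0.

Definition Mmat n (f : 'cV[R]_n -> 'cV[R]_n) (etainv : 'cV[R]_n -> 'cV[R]_n)
  (eta : 'cV[R]_n -> 'cV[R]_n) (z : 'cV[R]_n) : 'M[R]_n :=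
  \matrix_(i, j) Rintegral lebesgue_measure `[0%R, 1%R]
     (fun s : R => jac (f \o etainv) (s *: eta z) i j).

(* coordinate j (0-based, as a natural number) of a vector; 0 if out of range *)
Definition vcoord n (v : 'cV[R]_n) (j : nat) : R :=
  if insub j is Some i then v i 0 else 0.

Definition Tmat n (v : 'cV[R]_n) : 'M[R]_(n, n.-1) :=
  \matrix_(i, k) (if (i : nat) == (k : nat) then vcoord v k.+1
                  else if (i : nat) == k.+1 then - vcoord v k else 0).

Definition tridiagonal n (A : 'M[R]_n) : Prop :=
  forall i j : 'I_n, ((i.+1 < j)%N || (j.+1 < i)%N) -> A i j = 0.

Definition superdiag_is n (A : 'M[R]_n) (p : 'cV[R]_(n.-1)) : Prop :=
  forall i j : 'I_n, (j : nat) = i.+1 -> A i j = vcoord p i.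

End Defs.

(* Main.v *)
Require Import Defs.
From HB Require Import structures.
From mathcomp Require Import all_boot all_order all_algebra.
From mathcomp Require Import all_classical all_reals all_analysis.
From mathcomp Require Import ring lra.
Set Implicit Arguments. Unset Strict Implicit. Unset Printing Implicit Defensive.
Import Order.TTheory GRing.Theory Num.Theory.
Import numFieldNormedType.Exports.
Local Open Scope ring_scope.
Local Open Scope classical_set_scope.

(** Write v = eta z, M = M(z) and F = f o eta^-1. Since f = J eta with J skew,
    v^T F(t v) = 0 for every real t; differentiating in t gives
    v^T DF(s v) v = 0 for every s, and integrating over s in [0, 1] gives
    v^T M v = 0. That F is C^1 rests on the inverse function theorem for the
    bijection eta. Its inverse is continuous because, for y near eta x0, the
    function |eta x - y|^2 has an interior minimiser in a small ball around x0,
    which solves eta x = y as D eta is invertible.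

    It remains to find a skew K with K v = w, where w = M_H v is orthogonal to
    v, and to set P = - M_H + K. In general K = (w v^T - v w^T) / |v|^2 works. A
    tridiagonal skew K with superdiagonal p satisfies K v = T(v) p; under the
    nonvanishing assumptions T(v) is injective and its image is the orthogonal
    complement of v, so p, and hence P, exists and is unique. *)

(** * Skew matrices and the matrix T(v) *)

Section SymSkew.
Variables (R : realType) (n : nat).
Implicit Types (A K : 'M[R]_n) (v w : 'cV[R]_n).

Lemma symPart_skewPart A : symPart A + skewPart A = A.
Proof.
rewrite /symPart /skewPart -scalerDr addrACA subrr addr0 -mulr2n -(scaler_nat 2 A).
by rewrite scalerA mulVf ?scale1r// pnatr_eq0.
Qed.

Lemma tr_skewPart A : (skewPart A)^T = - skewPart A.
Proof. by rewrite /skewPart linearZ/= linearB/= trmxK -scalerN opprB. Qed.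

Lemma tr_symPart A : (symPart A)^T = symPart A.
Proof. by rewrite /symPart linearZ/= linearD/= trmxK addrC. Qed.

Lemma symPartD A K : symPart (A + K) = symPart A + symPart K.
Proof. by rewrite /symPart [(A + K)^T]linearD/= -scalerDr addrACA. Qed.

Lemma skewPartD A K : skewPart (A + K) = skewPart A + skewPart K.
Proof. by rewrite /skewPart [(A + K)^T]linearD/= -scalerDr opprD addrACA. Qed.

Lemma symPart_id A : A^T = A -> symPart A = A.
Proof.
move=> tA; rewrite /symPart tA -mulr2n -(scaler_nat 2 A) scalerA mulVf ?scale1r//.
Qed.

Lemma skewPart_sym A : A^T = A -> skewPart A = 0.
Proof. by move=> tA; rewrite /skewPart tA subrr scaler0. Qed.

Lemma symPart_skew K : K^T = - K -> symPart K = 0.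
Proof. by move=> tK; rewrite /symPart tK subrr scaler0. Qed.

Lemma skewPart_id K : K^T = - K -> skewPart K = K.
Proof. by move=> tK; have := symPart_skewPart K; rewrite symPart_skew// add0r. Qed.

(** The 1 x 1 matrix [x] equals its own transpose, while skewness of [K] gives [x^T = - x]. *)
Lemma skew_quad K v : K^T = - K -> v^T *m K *m v = 0.
Proof.
move=> tK; set x := v^T *m K *m v.
have tx : x^T = - x.
  by rewrite /x !trmx_mul trmxK tK mulNmx mulmxN mulmxA.
have xN : x = - x.
  by rewrite -tx; apply/matrixP => i j; rewrite [RHS]mxE !ord1.
apply/eqP; have : x *+ 2 == 0 by rewrite mulr2n {1}xN addNr.
by rewrite -scaler_nat scaler_eq0 pnatr_eq0.
Qed.

Lemma symPart_quad A v : v^T *m symPart A *m v = v^T *m A *m v.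
Proof.
rewrite -{2}(symPart_skewPart A) mulmxDr mulmxDl.
by rewrite (skew_quad v (tr_skewPart A)) addr0.
Qed.

Lemma quad_eq0 v : (v^T *m v == 0) = (v == 0).
Proof.
apply/eqP/eqP => [h|->]; last by rewrite mulmx0.
apply/colP => i; rewrite mxE; apply/eqP; rewrite -sqrf_eq0.
have /matrixP/(_ 0 0)/eqP := h; rewrite !mxE psumr_eq0.
  by move=> /allP/(_ i (mem_index_enum _)); rewrite /= !mxE -expr2.
by move=> j _; rewrite !mxE -expr2 sqr_ge0.
Qed.

Lemma skew_interpolation v w : v != 0 -> v^T *m w = 0 ->
  exists2 K, K^T = - K & K *m v = w.
Proof.
move=> v0 vw; pose q := (v^T *m v) 0 0.
have q0 : q != 0.
  apply: contraNneq v0 => q0; rewrite -quad_eq0; apply/eqP/matrixP => i j.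
  by rewrite !ord1 [LHS]q0 mxE.
have wv : w^T *m v = 0 by rewrite -(trmxK (w^T *m v)) trmx_mul trmxK vw trmx0.
exists (q^-1 *: (w *m v^T - v *m w^T)).
  by rewrite linearZ/= linearB/= !trmx_mul !trmxK -scalerN opprB.
rewrite -scalemxAl mulmxBl -!mulmxA wv mulmx0 subr0.
by rewrite [v^T *m v]mx11_scalar mul_mx_scalar scalerA mulVf// scale1r.
Qed.

End SymSkew.

(** * Tridiagonal skew matrices and their superdiagonals *)

Section Tridiagonal.
Variable R : realType.

Lemma vcoordE n (v : 'cV[R]_n) (i : 'I_n) : vcoord v i = v i 0.
Proof. by rewrite /vcoord valK. Qed.

Lemma vcoord_out n (v : 'cV[R]_n) k : (n <= k)%N -> vcoord v k = 0.
Proof. by move=> nk; rewrite /vcoord insubF// ltnNge nk. Qed.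

Lemma sum_vcoord n (v : 'cV[R]_n) (k : nat) (c : R) :
  \sum_(j < n) (if (j : nat) == k then c * v j 0 else 0) = c * vcoord v k.
Proof.
rewrite -big_mkcond/=; have [kn|nk] := ltnP k n.
  rewrite (big_pred1 (Ordinal kn)); first by rewrite -vcoordE.
  by move=> j; apply/eqP/eqP => [jk|->//]; exact: val_inj.
rewrite vcoord_out// mulr0 big_pred0// => j; apply/negbTE.
by rewrite neq_ltn (leq_trans (ltn_ord j) nk).
Qed.

(** Coordinates are indexed by naturals and default to 0 out of range, so the last row needs no case
    of its own; only row 0 lacks the subtracted term. *)
Lemma Tmat_mulE n (v : 'cV[R]_n) (p : 'cV[R]_n.-1) (i : 'I_n) :
  (Tmat v *m p) i 0 = vcoord v i.+1 * vcoord p i -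
    (if (i : nat) is k.+1 then vcoord v k * vcoord p k else 0).
Proof.
pose G (j : 'I_n.-1) : R := if (i : nat) is k.+1 then
  if (j : nat) == k then vcoord v k * p j 0 else 0 else 0.
rewrite mxE (eq_bigr (fun j : 'I_n.-1 =>
   (if (j : nat) == i then vcoord v i.+1 * p j 0 else 0) - G j)).
  rewrite big_split/= sumrN sum_vcoord; congr (_ - _).
  rewrite /G; case: (i : nat) => [|k]; first by rewrite big1.
  by rewrite sum_vcoord.
move=> j _; rewrite mxE /G eq_sym; case: eqP => [<-|ne].
  have -> : (match (j : nat) with 0%N => 0 | k.+1 =>
    if (j : nat) == k then vcoord v k * p j 0 else 0 end) = 0 :> R.
    by case: (nat_of_ord j) => // k; rewrite gtn_eqF.
  by rewrite subr0.
rewrite add0r; case: (nat_of_ord i) => [|k]; first by rewrite /= mul0r oppr0.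
rewrite eqSS eq_sym; case: eqP => [->|_]; first by rewrite mulNr.
by rewrite mul0r oppr0.
Qed.

Definition skew_tridiag n (p : 'cV[R]_n.-1) : 'M[R]_n :=
  \matrix_(i, j) (if (j : nat) == i.+1 then vcoord p i
                  else if (i : nat) == j.+1 then - vcoord p j else 0).

Lemma tr_skew_tridiag n (p : 'cV[R]_n.-1) :
  (skew_tridiag p)^T = - skew_tridiag p.
Proof.
apply/matrixP => i j; rewrite !mxE.
case: eqP => [->|_]; first by rewrite [X in if X then _ else _]ltn_eqF ?eqxx ?opprK.
by case: eqP => _; rewrite ?opprK ?oppr0.
Qed.

Lemma tridiagonal_skew_tridiag n (p : 'cV[R]_n.-1) :
  tridiagonal (skew_tridiag p).
Proof.
move=> i j; rewrite mxE => /orP[ij|ji].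
  by rewrite gtn_eqF// ltn_eqF// (ltn_trans _ (leqW ij)).
by rewrite ltn_eqF ?gtn_eqF// (ltn_trans _ (leqW ji)).
Qed.

(** The product is bilinear in [p] and [v], and [Tmat v] is its matrix as a linear map of [p]. This
    turns the unknown matrix into an unknown vector. *)
Lemma skew_tridiag_mul n (p : 'cV[R]_n.-1) (v : 'cV[R]_n) :
  skew_tridiag p *m v = Tmat v *m p.
Proof.
apply/colP => i; rewrite Tmat_mulE.
pose G (j : 'I_n) : R := if (i : nat) is k.+1 then
  if (j : nat) == k then vcoord p k * v j 0 else 0 else 0.
rewrite mxE (eq_bigr (fun j : 'I_n =>
   (if (j : nat) == i.+1 then vcoord p i * v j 0 else 0) - G j)).
  rewrite big_split/= sumrN sum_vcoord mulrC; congr (_ - _).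
  rewrite /G; case: (i : nat) => [|k]; first by rewrite big1.
  by rewrite sum_vcoord mulrC.
move=> j _; rewrite mxE /G; case: eqP => [->|ne].
  case: (nat_of_ord i) => [|k]; first by rewrite subr0.
  by rewrite gtn_eqF ?subr0// ltnS leqnSn.
rewrite add0r; case: (nat_of_ord i) => [|k]; first by rewrite /= mul0r oppr0.
rewrite eqSS eq_sym; case: eqP => [->|_]; first by rewrite mulNr.
by rewrite mul0r oppr0.
Qed.

Lemma skew_tridiagP n (K : 'M[R]_n) (p : 'cV[R]_n.-1) :
  K^T = - K -> tridiagonal K -> superdiag_is K p -> K = skew_tridiag p.
Proof.
move=> tK Ktri Kp.
have Kij i j : K i j = - K j i.
  by move/matrixP/(_ j i): tK; rewrite !mxE.
apply/matrixP => i j; rewrite mxE; case: eqP => [/Kp //|jSi].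
case: eqP => [/Kp KE|iSj]; first by rewrite Kij KE.
have [ij|ji|ij] := ltngtP i j.
- by apply: Ktri; rewrite ltn_neqAle ij eq_sym; move/eqP: jSi => ->.
- apply: Ktri; rewrite [X in _ || X]ltn_neqAle ji eq_sym.
  by move/eqP: iSj => ->; rewrite orbT.
- move/val_inj: ij => ->; apply/eqP; have /eqP := Kij j j.
  by rewrite -subr_eq0 opprK -mulr2n -mulr_natl mulf_eq0 pnatr_eq0.
Qed.

Lemma superdiag_exists n (K : 'M[R]_n) : exists p, superdiag_is K p.
Proof.
case: n K => [|n] K; first by exists 0 => -[].
exists (\col_(k < n) K (widen_ord (leqnSn n) k) (lift ord0 k)) => i j ji.
have iltn : (i < n)%N by rewrite -ltnS -ji.
rewrite (vcoordE _ (Ordinal iltn)) mxE; congr (K _ _); apply: val_inj => //=.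
Qed.

(** Column k of [Tmat v] is [K v], where [K] is the tridiagonal skew matrix whose superdiagonal is
    the k-th unit vector, and v^T K v = 0. *)
Lemma tr_Tmat_mul n (v : 'cV[R]_n) : v^T *m Tmat v = 0.
Proof.
apply/rowP => k; have := skew_quad v (tr_skew_tridiag (delta_mx k 0)).
rewrite -mulmxA skew_tridiag_mul mulmxA -colE => /matrixP/(_ 0 0).
by rewrite mxE => ->; rewrite !mxE.
Qed.

(** * Solvability of T(v) p = w *)

Section Solve.
Variables (n : nat) (v : 'cV[R]_n).
Hypothesis v0 : v != 0.
Hypothesis v_int : forall i : 'I_n, (0 < i)%N -> (i < n.-1)%N -> v i 0 != 0.

(** With indices from 0 and n = N + 1, row i reads v_{i+1} p_i = v_{i-1} p_{i-1}. Going down the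
    rows, the nonzero inner coordinates of v give v_{k+1} p_k = 0 for all k < N. *)
Lemma Tmat_inj (p : 'cV[R]_n.-1) : Tmat v *m p = 0 -> p = 0.
Proof.
case: n v p v0 v_int => [|N] u p u0 u_int Tp; first by apply/colP; case.
have row (i : nat) : (i <= N)%N -> vcoord u i.+1 * vcoord p i =
    (if i is k.+1 then vcoord u k * vcoord p k else 0).
  rewrite -ltnS => iN; have := Tmat_mulE u p (Ordinal iN).
  by rewrite Tp mxE => /esym/eqP; rewrite subr_eq0 => /eqP.
have u_ne k : (0 < k)%N -> (k < N)%N -> vcoord u k != 0.
  move=> k0 kN; have kN1 : (k < N.+1)%N by rewrite ltnS ltnW.
  by rewrite (vcoordE u (Ordinal kN1)); exact: u_int.
have fwd k : (k < N)%N -> vcoord u k.+1 * vcoord p k = 0.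
  elim: k => [|k ih] kN; first by rewrite row.
  rewrite (row _ (ltnW kN)); have /eqP := ih (ltnW kN).
  by rewrite mulf_eq0 (negbTE (u_ne _ _ kN))//= => /eqP ->; rewrite mulr0.
(* If p_k is nonzero, v_{k+1} = 0 forces k + 1 = N; the last row then gives v_k = 0, which forces k
   = 0. So n = 2 and both coordinates of v vanish, a contradiction. *)
apply/colP => k; rewrite mxE -vcoordE; apply/eqP; apply/negPn/negP => pk.
have kN : (k < N)%N by exact: ltn_ord.
have /eqP := fwd k kN; rewrite mulf_eq0 (negbTE pk) orbF => uk1.
have kE : k.+1 = N.
  apply/eqP; rewrite eqn_leq kN leqNgt; apply/negP => kN'.
  by have := u_ne k.+1 isT kN'; rewrite uk1.
have := row k.+1 kN; rewrite [vcoord p k.+1]vcoord_out ?kE//= mulr0.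
move/esym/eqP; rewrite mulf_eq0 (negbTE pk) orbF => uk.
have k0 : (k : nat) = 0%N.
  case: (posnP k) => // k_gt0; have := u_ne _ k_gt0 kN; by rewrite uk.
move/negP: u0; apply; apply/eqP/colP => i; rewrite mxE -vcoordE; apply/eqP.
have : (i < 2)%N by rewrite -[2%N]/(0.+2)%N -k0 kE ltn_ord.
case: (nat_of_ord i) => [|[|//]] _; first by rewrite -k0.
by rewrite -[1%N]/(0.+1)%N -k0.
Qed.

Lemma rank_Tmat : \rank (Tmat v) = n.-1.
Proof.
rewrite -mxrank_tr; apply/eqP; rewrite -/(row_free _) -kermx_eq0.
apply/eqP/row_matrixP => i; rewrite row0.
have : row i (kermx (Tmat v)^T) *m (Tmat v)^T = 0.
  by rewrite -row_mul mulmx_ker row0.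
move/(congr1 trmx); rewrite trmx_mul trmxK trmx0 => /Tmat_inj/(congr1 trmx).
by rewrite trmxK trmx0.
Qed.

(* The image of T(v) lies in the orthogonal complement of v, and both have
   dimension n - 1. *)
Lemma Tmat_surj (w : 'cV[R]_n) : v^T *m w = 0 -> exists p, Tmat v *m p = w.
Proof.
move=> vw.
have sub : ((Tmat v)^T <= kermx v)%MS.
  by apply/sub_kermxP; rewrite -[LHS]trmxK trmx_mul trmxK tr_Tmat_mul trmx0.
have rkv : \rank v = 1%N.
  apply/eqP; rewrite eqn_leq rank_leq_col lt0n mxrank_eq0; exact: v0.
have eqr : \rank (Tmat v)^T == \rank (kermx v).
  by rewrite mxrank_tr rank_Tmat mxrank_ker rkv subn1.
move: eqr; rewrite (mxrank_leqif_sup sub) => sup.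
have /submx_trans/(_ sup)/submxP[D wD] : (w^T <= kermx v)%MS.
  by apply/sub_kermxP; rewrite -[LHS]trmxK trmx_mul trmxK vw trmx0.
by exists D^T; rewrite -[RHS]trmxK wD trmx_mul trmxK.
Qed.

Lemma Tmat_unique (p q : 'cV[R]_n.-1) : Tmat v *m p = Tmat v *m q -> p = q.
Proof.
move=> pq; apply/eqP; rewrite -subr_eq0; apply/eqP/Tmat_inj.
by rewrite mulmxBr pq subrr.
Qed.

End Solve.

(** * Completing a symmetric part so that v is annihilated *)

Section Completion.
Variables (n : nat) (v : 'cV[R]_n) (A : 'M[R]_n).
Hypothesis Av : v^T *m A *m v = 0.

Lemma skew_completion : exists P : 'M[R]_n,
  P *m v = 0 /\ symPart A + symPart P = 0.
Proof.
have symN : symPart (- symPart A) = - symPart A.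
  by apply: symPart_id; rewrite linearN/= tr_symPart.
(* The interpolating skew matrix divides by |v|^2, so v = 0 is treated apart: there the symmetric
   part alone suffices. *)
have [v0|v0] := eqVneq v 0.
  by exists (- symPart A); rewrite v0 mulmx0 symN subrr.
have [|K tK Kv] := @skew_interpolation _ _ v (symPart A *m v) v0.
  by rewrite mulmxA symPart_quad.
exists (- symPart A + K); split; first by rewrite mulmxDl mulNmx Kv addNr.
by rewrite symPartD symN (symPart_skew tK) addr0 subrr.
Qed.

(** Splitting [P] in P v = 0 gives P_S v = - P_H v = A_H v, and P_S acts on v as [Tmat v] acts on
    [p]. *)
Lemma skew_completion_superdiag (P : 'M[R]_n) (p : 'cV[R]_n.-1) :
  P *m v = 0 -> symPart P = - symPart A -> tridiagonal (skewPart P) ->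
  superdiag_is (skewPart P) p -> Tmat v *m p = symPart A *m v.
Proof.
move=> Pv symP triP /(skew_tridiagP (tr_skewPart P) triP) KE.
rewrite -skew_tridiag_mul -KE; apply/eqP; rewrite -subr_eq0 -mulmxBl.
by rewrite -symP addrC symPart_skewPart Pv.
Qed.

Hypothesis v0 : v != 0.
Hypothesis v_int : forall i : 'I_n, (0 < i)%N -> (i < n.-1)%N -> v i 0 != 0.

Lemma Tmat_exists_unique : exists! p, Tmat v *m p = symPart A *m v.
Proof.
have [|p pE] := Tmat_surj v0 v_int (w := symPart A *m v).
  by rewrite mulmxA symPart_quad.
by exists p; split=> // q qE; apply: (Tmat_unique v0 v_int); rewrite pE qE.
Qed.

Lemma tridiagonal_completion_unique : exists! P : 'M[R]_n,
  P *m v = 0 /\ symPart P = - symPart A /\ tridiagonal (skewPart P).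
Proof.
have [p [pE pU]] := Tmat_exists_unique.
have symN : (- symPart A)^T = - symPart A by rewrite linearN/= tr_symPart.
exists (- symPart A + skew_tridiag p); split.
  split; first by rewrite mulmxDl mulNmx skew_tridiag_mul pE addNr.
  rewrite symPartD skewPartD (symPart_id symN) (skewPart_sym symN).
  rewrite (symPart_skew (tr_skew_tridiag p)) (skewPart_id (tr_skew_tridiag p)).
  by rewrite addr0 add0r; split=> //; exact: tridiagonal_skew_tridiag.
(* Uniqueness: the symmetric part is prescribed, and the superdiagonal of the skew part solves the
   same system as [p]. *)
move=> P [Pv [symP triP]]; rewrite -(symPart_skewPart P) symP; congr (_ + _).
have [q qP] := superdiag_exists (skewPart P).
rewrite (pU q (skew_completion_superdiag Pv symP triP qP)).
exact/esym/(skew_tridiagP (tr_skewPart P) triP qP).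
Qed.

Lemma superdiag_iff (P : 'M[R]_n) (p : 'cV[R]_n.-1) :
  P *m v = 0 -> symPart P = - symPart A -> tridiagonal (skewPart P) ->
  superdiag_is (skewPart P) p <-> Tmat v *m p = symPart A *m v.
Proof.
move=> Pv symP triP; split; first exact: skew_completion_superdiag.
(* The actual superdiagonal [q] of the skew part solves the system too, so injectivity of [Tmat v]
   identifies it with [p]. *)
move=> pE; have [q qP] := superdiag_exists (skewPart P).
suff -> : p = q by [].
apply: (Tmat_unique v0 v_int); rewrite pE.
exact/esym/(skew_completion_superdiag Pv symP triP qP).
Qed.

End Completion.
End Tridiagonal.

(** * Continuity of matrix-valued maps *)

Section MatrixContinuity.
Variable R : realType.

(** Neighbourhoods of a matrix are generated by entrywise conditions, and a filter can meet finitely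
    many of them at once. *)
Lemma cvg_mx (T : Type) (F : set_system T) (FF : Filter F) m n
    (g : T -> 'M[R]_(m, n)) (l : 'M[R]_(m, n)) :
  (forall i j, g x i j @[x --> F] --> l i j) -> g x @[x --> F] --> l.
Proof.
move=> gl A [P lP sPA].
have : \forall x \near F, forall i j, P i j (g x i j).
  by apply: filter_forall => i; apply: filter_forall => j; exact: (gl i j _ (lP i j)).
by apply: filterS => x Px; exact: sPA.
Qed.

Lemma continuous_mx (T : topologicalType) m n (g : T -> 'M[R]_(m, n)) :
  (forall i j, continuous (fun x => g x i j)) -> continuous g.
Proof. by move=> cg x; apply: cvg_mx => i j; exact: cg. Qed.

Lemma continuous_entry (T : topologicalType) m n (g : T -> 'M[R]_(m, n)) i j :
  continuous g -> continuous (fun x => g x i j).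
Proof.
move=> cg x; apply: (@continuous_comp _ _ _ g (fun M => M i j) x); first exact: cg.
exact: coord_continuous.
Qed.

Lemma continuous_sum_fun (T : topologicalType) (I : Type) (r : seq I) (P : pred I)
    (F : I -> T -> R) : (forall i, P i -> continuous (F i)) ->
  continuous (fun x => \sum_(i <- r | P i) F i x).
Proof. by move=> cF; apply: continuous_big => //; exact: add_continuous. Qed.

Lemma continuous_prod_fun (T : topologicalType) (I : Type) (r : seq I) (P : pred I)
    (F : I -> T -> R) : (forall i, P i -> continuous (F i)) ->
  continuous (fun x => \prod_(i <- r | P i) F i x).
Proof. by move=> cF; apply: continuous_big => //; exact: mul_continuous. Qed.

Lemma continuous_mulmx (T : topologicalType) m n p (A : T -> 'M[R]_(m, n))
    (B : T -> 'M[R]_(n, p)) :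
  continuous A -> continuous B -> continuous (fun x => A x *m B x).
Proof.
move=> cA cB; apply: continuous_mx => i j.
rewrite (_ : (fun x => _) = fun x => \sum_k A x i k * B x k j); last first.
  by apply/funext => x; rewrite mxE.
apply: continuous_sum_fun => k _ x.
by apply: cvgM; exact: continuous_entry.
Qed.

Lemma continuous_mulmxl m p q (A : 'M[R]_(m, p)) :
  continuous (mulmx A : 'M[R]_(p, q) -> 'M[R]_(m, q)).
Proof.
apply: (@continuous_mulmx _ _ _ _ (cst A) id) => x; first exact: cst_continuous.
exact.
Qed.

Lemma continuous_det (T : topologicalType) n (A : T -> 'M[R]_n) :
  continuous A -> continuous (fun x => \det (A x)).
Proof.
move=> cA; rewrite /determinant; apply: continuous_sum_fun => s _ x.
apply: cvgM; first exact: cvg_cst.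
by apply: continuous_prod_fun => i _; exact: continuous_entry.
Qed.

(** Cramer's rule: the inverse is the adjugate over the determinant, and cofactors are signed
    determinants of submatrices. *)
Lemma continuous_invmx (T : topologicalType) n (A : T -> 'M[R]_n) :
  continuous A -> (forall x, A x \in unitmx) -> continuous (fun x => invmx (A x)).
Proof.
move=> cA uA; apply: continuous_mx => i j.
have cadj : continuous (fun x => \adj (A x) i j).
  rewrite (_ : (fun x => _) = fun x =>
      (-1) ^+ (j + i) * \det (row' j (col' i (A x)))); last first.
    by apply/funext => y; rewrite mxE.
  move=> x; apply: cvgMl_tmp; move: x.
  apply: continuous_det; apply: continuous_mx => k l.
  rewrite (_ : (fun x => _) = fun x => A x (lift j k) (lift i l)); last first.
    by apply/funext => y; rewrite !mxE.
  exact: continuous_entry.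
rewrite (_ : (fun x => _) = fun x => (\det (A x))^-1 * \adj (A x) i j); last first.
  by apply/funext => x; rewrite /invmx uA mxE.
move=> x; apply: cvgM; last exact: cadj.
apply: cvgV; last exact: continuous_det.
by have := uA x; rewrite unitmxE unitfE.
Qed.

(** The norm is the sup norm, so the closed ball is the transposed image of a product of
    segments. *)
Lemma cV_ball_compact n (x0 : 'cV[R]_n) (r : R) : 0 <= r ->
  compact [set x | `|x - x0| <= r].
Proof.
move=> r0.
have -> : [set x | `|x - x0| <= r] = trmx @`
    [set v : 'rV[R]_n | forall i, `[x0 i 0 - r, x0 i 0 + r] (v ord0 i)].
  apply/seteqP; split => [x /= xr|_ /= [v vr <-]].
    exists x^T; last by rewrite trmxK.
    move=> i; rewrite /= in_itv/= mxE -ler_distl.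
    apply: le_trans xr; rewrite [leRHS]/Num.Def.normr/= mx_normrE.
    by apply: le_trans; last exact: (le_bigmax _ _ (i, ord0)); rewrite !mxE.
  rewrite [leLHS]/Num.Def.normr/= mx_normrE (bigmax_le _ r0)//= => -[i j] _.
  by rewrite !mxE/= !ord1; have := vr i; rewrite /= in_itv/= -ler_distl.
apply: continuous_compact.
  apply: continuous_subspaceT; apply: continuous_mx => i j.
  rewrite (_ : (fun x => _) = fun x : 'rV[R]_n => x j i); first exact: coord_continuous.
  by apply/funext => x; rewrite mxE.
apply: (@rV_compact _ _ (fun i => `[x0 i 0 - r, x0 i 0 + r])) => i.
exact: segment_compact.
Qed.

End MatrixContinuity.

(** * Jacobian matrices and differentials *)

Section Jacobian.
Variable R : realType.

Lemma diff_jac n m (g : 'cV[R]_n -> 'cV[R]_m) x v :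
  differentiable g x -> 'd g x v = jac g x *m v.
Proof.
move=> dg; have vE : v = \sum_j v j 0 *: ebasis R j.
  by rewrite {1}[v]matrix_sum_delta; apply: eq_bigr => j _; rewrite big_ord1.
rewrite {1}vE linear_sum; apply/colP => i; rewrite summxE mxE.
by apply: eq_bigr => j _; rewrite linearZ/= !mxE deriveE// mulrC.
Qed.

Lemma jac_unique n m (g : 'cV[R]_n -> 'cV[R]_m) x (A : 'M[R]_(m, n)) :
  differentiable g x -> (forall v, 'd g x v = A *m v) -> jac g x = A.
Proof.
move=> dg dgA; apply/matrixP => i j; rewrite mxE deriveE// dgA /ebasis -colE.
by rewrite mxE.
Qed.

Lemma continuous_jac n m (g : 'cV[R]_n -> 'cV[R]_m) : C1 g -> continuous (jac g).
Proof.
move=> [_ cg]; apply: continuous_mx => i j.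
rewrite (_ : (fun x => _) = fun x => ('D_(ebasis R j) g x) i 0); last first.
  by apply/funext => x; rewrite mxE.
exact: continuous_entry.
Qed.

End Jacobian.

(** * The inverse of a differentiable bijection with invertible Jacobian *)

Section InverseContinuity.
Variables (R : realType) (n : nat).

(** The squared Euclidean norm. The ambient norm is the sup norm, which is not differentiable in
    general; it defines the balls, while [sqnorm] is what gets minimised. *)
Definition sqnorm (w : 'cV[R]_n) : R := \sum_i w i 0 ^+ 2.

Lemma sqnorm_ge0 w : 0 <= sqnorm w.
Proof. by apply: sumr_ge0 => i _; exact: sqr_ge0. Qed.

Lemma sqnorm_eq0 w : sqnorm w = 0 -> w = 0.
Proof.
move=> /eqP; rewrite psumr_eq0 => [/allP h|i _]; last exact: sqr_ge0.
apply/colP => i; rewrite mxE; apply/eqP.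
by have := h i (mem_index_enum _); rewrite /= sqrf_eq0.
Qed.

Lemma sqnorm0 : sqnorm 0 = 0.
Proof. by rewrite /sqnorm big1// => i _; rewrite mxE expr0n. Qed.

Lemma sqnormN w : sqnorm (- w) = sqnorm w.
Proof. by apply: eq_bigr => i _; rewrite mxE sqrrN. Qed.

Lemma sqnormD u w : sqnorm (u + w) <= 2 * sqnorm u + 2 * sqnorm w.
Proof.
rewrite !mulr_sumr -big_split/=; apply: ler_sum => i _; rewrite mxE -subr_ge0.
rewrite (_ : _ - _ = (u i 0 - w i 0) ^+ 2) ?sqr_ge0//.
by rewrite sqrrD sqrrB !mulr2n !mulrDl !mul1r; ring.
Qed.

Lemma differentiable_sqnorm_sub (g : 'cV[R]_n -> 'cV[R]_n) y x :
  differentiable g x -> differentiable (fun x => sqnorm (g x - y)) x.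
Proof.
move=> dg.
rewrite (_ : (fun x => _) = \sum_(i < n) (fun x => g x i 0 - y i 0) ^+ 2); last first.
  by apply/funext => z; rewrite fct_sumE; apply: eq_bigr => i _; rewrite !mxE.
apply: differentiable_sum => i; apply: differentiableX.
apply: differentiableB => //.
exact: (differentiable_comp dg (differentiable_coord _ _ _)).
Qed.

Lemma derive_sqnorm_sub (g : 'cV[R]_n -> 'cV[R]_n) y x v :
  differentiable g x ->
  'D_v (fun x => sqnorm (g x - y)) x = 2 * ((g x - y)^T *m (jac g x *m v)) 0 0.
Proof.
move=> dg.
have dgi i : derivable (fun x => g x i 0) x v.
  by apply: (derivable_mxP _ _ _).1; exact: diff_derivable.
rewrite (_ : (fun x => _) = \sum_(i < n) (fun x => g x i 0 - y i 0) ^+ 2); last first.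
  by apply/funext => z; rewrite fct_sumE; apply: eq_bigr => i _; rewrite !mxE.
have dgyi i : derivable (fun x => g x i 0 - y i 0) x v.
  by apply: derivableB.
rewrite derive_sum; last by move=> i; exact: derivableX.
rewrite mxE mulr_sumr; apply: eq_bigr => i _.
rewrite deriveX// deriveB// derive_cst subr0 -diff_jac// -deriveE//.
rewrite derive_mx; last exact: diff_derivable.
by rewrite !mxE expr1 -mulr_natl mulrA.
Qed.

(** Restriction to the line t v + c reduces this to the one-variable criterion. *)
Lemma derive_at_local_min (V : normedModType R) (Q : V -> R) (c v : V) (r : R) :
  (forall x, differentiable Q x) -> 0 < r ->
  (forall x, `|x - c| < r -> Q c <= Q x) -> 'D_v Q c = 0.
Proof.
move=> dQ r0 Qmin.
have dline (t : R) : is_diff t (fun t : R => t *: v + c) ( *:%R^~ v).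
  by apply: is_diff_eq; rewrite addr0.
pose psi := Q \o (fun t : R => t *: v + c).
(* For |t| < d the point t v + c stays within r of c; the added 1 keeps the denominator positive
   when v = 0. *)
pose d := r / (`|v| + 1).
have v1 : 0 < `|v| + 1 by rewrite ltr_wpDl.
have d0 : 0 < d by rewrite divr_gt0.
have dpsi t : derivable psi t 1.
  by apply: diff_derivable; apply: differentiable_comp.
have psi0 : is_derive (0 : R) (1 : R) psi 0.
  apply: (@derive1_at_min R psi (- d) d 0).
  - by rewrite ge0_cp// ltW.
  - by move=> t _; exact: dpsi.
  - by rewrite in_itv/= oppr_lt0 d0.
  move=> t; rewrite in_itv/= -ltr_norml => td.
  rewrite /psi/= scale0r add0r; apply: Qmin; rewrite addrK normrZ.
  apply: (le_lt_trans (y := `|t| * (`|v| + 1))).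
    by rewrite ler_wpM2l// lerDl.
  by rewrite -ltr_pdivlMr.
have : 'D_1 psi 0 = 0 by rewrite derive_val.
rewrite deriveE; last exact: differentiable_comp.
rewrite /psi diff_comp//= diff_val /= scale1r scale0r add0r.
by rewrite deriveE.
Qed.

End InverseContinuity.

Section Inverse.
Variables (R : realType) (n : nat) (g ginv : 'cV[R]_n -> 'cV[R]_n).
Hypotheses (dg : forall x, differentiable g x)
  (ug : forall x, jac g x \in unitmx) (gK : cancel g ginv) (ginvK : cancel ginv g).

Let continuous_sqnorm y : continuous (fun x => sqnorm (g x - y)).
Proof. by move=> x; exact/differentiable_continuous/differentiable_sqnorm_sub. Qed.

(** In the direction Dg(c)^{-1} (g c - y) the derivative equals 2 |g c - y|^2. *)
Lemma sqnorm_critical y c :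
  (forall v, 'D_v (fun x => sqnorm (g x - y)) c = 0) -> g c = y.
Proof.
move=> crit; have := crit (invmx (jac g c) *m (g c - y)).
rewrite derive_sqnorm_sub// mulKVmx// => /eqP.
rewrite mulf_eq0 pnatr_eq0/= => /eqP gcy.
apply/eqP; rewrite -subr_eq0 -quad_eq0; apply/eqP/matrixP => i j.
by rewrite !ord1 gcy mxE.
Qed.

(** By injectivity g x differs from g x0 on the sphere, and compactness turns this into a uniform
    gap. *)
Lemma sphere_separation (x0 : 'cV[R]_n) (e : R) : 0 < e ->
  exists2 mu, 0 < mu & forall x, `|x - x0| = e -> mu <= sqnorm (g x - g x0).
Proof.
move=> e0; pose S := [set x : 'cV[R]_n | `|x - x0| = e].
(* The sphere is empty when n = 0; any positive [mu] then works. *)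
have [S0|/set0P S0] := eqVneq S set0.
  by exists 1 => // x xe; have : S x by []; rewrite S0.
have cS : compact S.
  apply: (subclosed_compact _ (@cV_ball_compact _ _ x0 _ (ltW e0))); last first.
    by move=> x /= ->.
  rewrite (_ : S = (fun x : 'cV[R]_n => `|x - x0|) @^-1` [set e])//.
  apply: preimage_closed; last exact: closed_eq.
  move=> x _; apply: (@continuous_comp _ _ _ (fun x : 'cV[R]_n => x - x0)).
    exact/differentiable_continuous/differentiableB.
  exact: norm_continuous.
have [|c] := compact_EVT_min S0 cS (f := fun x => sqnorm (g x - g x0)).
  exact: continuous_subspaceT.
rewrite inE => cS' cmin.
exists (sqnorm (g c - g x0)); last by move=> x xe; apply: cmin; rewrite inE.
rewrite lt_neqAle sqnorm_ge0 andbT eq_sym; apply: contraTneq isT.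
move=> /sqnorm_eq0/eqP; rewrite subr_eq0 => /eqP/(can_inj gK) cx0.
by move: cS' e0; rewrite /S/= cx0 subrr normr0 => <-; rewrite ltxx.
Qed.

Lemma inverse_near (y0 : 'cV[R]_n) (e : R) : 0 < e ->
  \forall y \near y0, `|ginv y0 - ginv y| <= e.
Proof.
move=> e0; set x0 := ginv y0.
have [mu mu0 sep] := sphere_separation x0 e0.
(* Why 4: were the minimiser [c] on the sphere, then mu <= |g c - y0|^2 <= 2 |g c - y|^2 + 2 |y -
   y0|^2 <= 4 |y - y0|^2 < mu. *)
have /= near_y : \forall y \near y0, sqnorm (y - y0) < mu / 4.
  have cs : {for y0, continuous (fun y : 'cV[R]_n => sqnorm (y - y0))}.
    exact/differentiable_continuous/(@differentiable_sqnorm_sub _ _ id).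
  have /cvgr_lt := cs; apply; rewrite subrr sqnorm0 divr_gt0//.
near=> y.
have ymu : sqnorm (y - y0) < mu / 4 by near: y.
have K0 : [set x | `|x - x0| <= e] !=set0.
  by exists x0; rewrite /= subrr normr0 ltW.
have [|c] := compact_EVT_min K0 (@cV_ball_compact _ _ x0 _ (ltW e0))
    (f := fun x => sqnorm (g x - y)).
  exact: continuous_subspaceT.
rewrite inE/= => cK cmin.
have cx0 : sqnorm (g c - y) <= sqnorm (y - y0).
  rewrite -(sqnormN (y - y0)) opprB -(ginvK y0) -/x0; apply: cmin.
  by rewrite inE/= subrr normr0 ltW.
suff gcy : g c = y by rewrite -gcy gK distrC.
apply: sqnorm_critical => v.
have cint : `|c - x0| < e.
  rewrite lt_neqAle cK andbT; apply/eqP => /sep; rewrite /x0 ginvK.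
  have := sqnormD (g c - y) (y - y0); rewrite subrKA; lra.
apply: (@derive_at_local_min _ _ _ c v (e - `|c - x0|)).
- by move=> x; exact: differentiable_sqnorm_sub.
- by rewrite subr_gt0.
move=> x; rewrite ltrBrDr => xc; apply: cmin; rewrite inE/=.
rewrite -(subrKA c); exact: (le_trans (ler_normD _ _) (ltW xc)).
Unshelve. all: by end_near. Qed.

Lemma continuous_inverse : continuous ginv.
Proof.
move=> y0; apply: (iffRL (@cvgrPdist_le _ _ _ (nbhs (y0 : 'cV[R]_n)) _ _ _)).
exact: inverse_near.
Qed.

Let V : normedModType R := 'cV[R]_n.

Let B (y : 'cV[R]_n) : 'M[R]_n := invmx (jac g (ginv y)).

(** With k = ginv (h + y) - ginv y, differentiability of g gives h = Dg k + o(k), hence k - B h = -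
    B o(k). Continuity of [ginv] makes k small, and a bound of |k| by a multiple of |h| turns o(k)
    into o(h). *)
Lemma inverse_expansion (y : V) :
  (ginv : V -> V) \o shift y = cst (ginv y) + (mulmx (B y) : V -> V) +o_ 0 id.
Proof.
apply/eqaddoP => e e0.
have [C C0 BC] := linear_lipschitz (@continuous_mulmxl R n n 1 (B y)).
have [_ /eqaddoP gexp] := (diff_locallyP (ginv y) g).1 (dg _).
(* The first bound gives C e' <= 1/2, so the error is absorbed into |k| and |k| <= 2 C |h|; the
   second bounds the final error 2 C^2 e' |h| by e |h|. *)
pose e' := Num.min (2 * C)^-1 (e / (2 * C ^+ 2)).
have e'0 : 0 < e'.
  by rewrite lt_min invr_gt0 mulr_gt0//= divr_gt0// mulr_gt0// exprn_gt0.
have /nbhs_ballP[r /= r0 rk] := gexp _ e'0.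
have /nbhs_ballP[d /= d0 dh] := inverse_near y (divr_gt0 r0 (ltr0Sn R 1)).
apply/nbhs_ballP; exists d => //= h hd; set k := ginv (h + y) - ginv y.
have /rk : ball (0 : V) r k.
  rewrite -ball_normE /= sub0r normrN /k distrC.
  have /dh/le_lt_trans : ball y d (h + y).
    move: hd; rewrite -!ball_normE /= sub0r normrN => hd.
    by rewrite opprD addrCA subrr addr0 normrN.
  by apply; rewrite ltr_pdivrMr// ltr_pMr// ltr1n.
rewrite /= !fctE /= /shift /= => kh.
have khE : k - B y *m h = - (B y *m (g (k + ginv y) - (g (ginv y) + 'd g (ginv y) k))).
  rewrite /k subrK !ginvK opprD addrA addrK mulmxBr opprB diff_jac//.
  by rewrite /B mulKmx.
have h1 : `|k - B y *m h| <= C * (e' * `|k|).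
  rewrite khE normrN; apply: le_trans (BC _) _.
  by rewrite ler_pM2l.
have h2 : `|B y *m h| <= C * `|h| by exact: BC.
have h3 : `|k| <= `|k - B y *m h| + `|B y *m h|.
  by rewrite -{1}(subrK (B y *m h) k) ler_normD.
have h4 : C * e' <= 2^-1.
  rewrite mulrC -ler_pdivlMr// -invfM mulrC ge_min mulrC lexx//.
have h5 : C ^+ 2 * e' <= e / 2.
  rewrite mulrC -ler_pdivlMr ?exprn_gt0// -mulrA -invfM ge_min lexx orbT//.
rewrite opprD addrA -/k; apply: (le_trans h1).
have h6 : `|k| <= 2 * C * `|h|.
  have Cek : C * (e' * `|k|) <= 2^-1 * `|k| by rewrite mulrA ler_wpM2r.
  have := le_trans h3 (lerD (le_trans h1 Cek) h2).
  move: `|k| `|h| => a b; lra.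
apply: (le_trans (y := C * (e' * (2 * C * `|h|)))).
  by rewrite !ler_pM2l.
rewrite (_ : _ * _ = 2 * (C ^+ 2 * e') * `|h|); last by ring.
by rewrite ler_wpM2r//; lra.
Qed.

Lemma diff_inverse y : 'd ginv y = mulmx (B y) :> ('cV[R]_n -> 'cV[R]_n).
Proof.
exact: (diff_unique (@continuous_mulmxl R n n 1 (B y)) (inverse_expansion y)).
Qed.

Lemma differentiable_inverse y : differentiable ginv y.
Proof.
apply/diff_locallyP; rewrite diff_inverse; split; last exact: inverse_expansion.
exact: continuous_mulmxl.
Qed.

Lemma jac_comp_inverse m (f : 'cV[R]_n -> 'cV[R]_m) y :
  differentiable f (ginv y) -> jac (f \o ginv) y = jac f (ginv y) *m B y.
Proof.
move=> df; have di := differentiable_inverse y.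
apply: jac_unique; first exact: differentiable_comp.
by move=> v; rewrite diff_comp//= diff_inverse diff_jac// mulmxA.
Qed.

Lemma continuous_jac_comp_inverse m (f : 'cV[R]_n -> 'cV[R]_m) :
  C1 f -> continuous (jac g) -> continuous (jac (f \o ginv)).
Proof.
move=> C1f cjg.
rewrite (_ : jac _ = fun y => jac f (ginv y) *m B y); last first.
  by apply/funext => y; apply: jac_comp_inverse; have [] := C1f.
apply: continuous_mulmx => [y|].
  apply: (@continuous_comp _ _ _ ginv (jac f)); first exact: continuous_inverse.
  exact: continuous_jac.
apply: continuous_invmx => // y.
by apply: (@continuous_comp _ _ _ ginv (jac g)); [exact: continuous_inverse|exact: cjg].
Qed.

End Inverse.

(** * The quadratic form of M(z) *)

Section SegmentIntegral.
Variable R : realType.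

(** Serves to bring the double sum v^T M v under the integral; continuity gives integrability on the
    segment. *)
Lemma Rintegral_lincomb (I : Type) (r : seq I) (c : I -> R) (h : I -> R -> R) (a b : R) :
  (forall i, continuous (h i)) ->
  \sum_(i <- r) c i * Rintegral lebesgue_measure `[a, b] (h i) =
  Rintegral lebesgue_measure `[a, b] (fun s => \sum_(i <- r) c i * h i s).
Proof.
move=> ch.
have int (k : R -> R) : continuous k ->
    lebesgue_measure.-integrable `[a, b] (EFin \o k).
  move=> ck; apply: continuous_compact_integrable; first exact: segment_compact.
  exact: continuous_subspaceT.
have cch i : continuous (fun s => c i * h i s).
  by move=> s; apply: cvgMl_tmp; exact: ch.
elim: r => [|i r ih].
  rewrite big_nil (_ : (fun s => _) = cst 0); first by rewrite Rintegral_cst// mul0r.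
  by apply/funext => s; rewrite big_nil.
rewrite big_cons ih -RintegralZl//; last exact: int.
rewrite -RintegralD//; [|exact: int|apply: int; exact: continuous_sum_fun].
by congr Rintegral; apply/funext => s; rewrite big_cons.
Qed.

End SegmentIntegral.

(** The map t |-> v^T F(t v) vanishes identically, and the chain rule computes its derivative at s
    as v^T DF(s v) v. *)
Lemma radial_quad_eq0 (R : realType) n (F : 'cV[R]_n -> 'cV[R]_n) (v : 'cV[R]_n) (s : R) :
  (forall x, differentiable F x) -> (forall t : R, v^T *m F (t *: v) = 0) ->
  v^T *m jac F (s *: v) *m v = 0.
Proof.
move=> dF vF.
have dFl : differentiable (F \o *:%R^~ v) s by apply: differentiable_comp.
have dvT : differentiable (mulmx v^T : 'cV[R]_n -> 'M[R]_1) (F (s *: v)).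
  exact/linear_differentiable/continuous_mulmxl.
have vF0 : mulmx v^T \o (F \o *:%R^~ v) = cst 0 by apply/funext => t; exact: vF.
have := diff_comp dFl dvT; rewrite vF0 diff_cst => /(congr1 (@^~ (1 : R))) /=.
rewrite diff_comp//= diff_lin; last exact: continuous_mulmxl.
by rewrite diff_val/= scale1r diff_jac// mulmxA => <-.
Qed.

Lemma Mmat_quad_eq0 (R : realType) n (f eta etainv : 'cV[R]_n -> 'cV[R]_n)
    (J : 'cV[R]_n -> 'M[R]_n) (z : 'cV[R]_n) :
  C1 f -> C1 eta -> cancel eta etainv -> cancel etainv eta ->
  (forall z, jac eta z \in unitmx) ->
  (forall z, (J z)^T = - J z) -> (forall z, f z = J z *m eta z) ->
  f (etainv 0) = 0 ->
  (eta z)^T *m Mmat f etainv eta z *m eta z = 0.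
Proof.
move=> C1f C1eta etaK etainvK ujac tJ fJ f0; set v := eta z.
have [df _] := C1f; have [deta _] := C1eta.
pose F := f \o etainv.
have dF x : differentiable F x.
  exact: (differentiable_comp (differentiable_inverse deta ujac etaK etainvK _)).
have cjF : continuous (jac F).
  apply: (continuous_jac_comp_inverse deta ujac etaK etainvK C1f).
  exact: continuous_jac.
have vF (t : R) : v^T *m F (t *: v) = 0.
  (* For t nonzero, F(t v) is t times a skew matrix applied to v, so pairing with v gives 0; the
     value at t = 0 is [f0]. *)
  have [->|t0] := eqVneq t 0; first by rewrite scale0r /F/= f0 mulmx0.
  rewrite /F/= fJ etainvK -scalemxAr -scalemxAr mulmxA.
  by rewrite skew_quad// scaler0.
have cjFs i j : continuous (fun s : R => jac F (s *: v) i j).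
  apply: (@continuous_entry _ _ _ _ (fun s : R => jac F (s *: v))) => s.
  apply: (@continuous_comp R 'cV[R]_n 'M[R]_n (fun s : R => s *: v) (jac F)).
    exact: scalel_continuous.
  exact: cjF.
apply/matrixP => a b; rewrite !ord1 !mxE.
under eq_bigr => j _ do rewrite mxE big_distrl/=.
(* One sum over pairs of indices lets the integral be exchanged with it in a single step; the
   integrand becomes v^T DF(s v) v. *)
rewrite pair_bigA/=.
rewrite (eq_bigr (fun p : 'I_n * 'I_n => (v p.2 0 * v p.1 0) *
   Rintegral lebesgue_measure `[0, 1] (fun s => jac F (s *: v) p.2 p.1))); last first.
  by move=> p _; rewrite !mxE mulrAC.
rewrite Rintegral_lincomb; last by move=> p; exact: cjFs.
rewrite (_ : (fun s => _) = cst 0); first by rewrite Rintegral_cst// mul0r.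
apply/funext => s; have /matrixP/(_ 0 0) := radial_quad_eq0 s dF vF.
rewrite [RHS]mxE => quad0; apply: etrans quad0; rewrite [RHS]mxE.
rewrite -(pair_bigA _ (fun j i => v i 0 * v j 0 * jac F (s *: v) i j))/=.
apply: eq_bigr => j _; rewrite [in RHS]mxE big_distrl/=; apply: eq_bigr => i _.
by rewrite [v^T _ _]mxE mulrAC.
Qed.

(** * Existence of P and its unique tridiagonal choice *)

Theorem mainTheorem6 (R : realType) (n m : nat)
  (H : 'cV[R]_n -> R) (eta : 'cV[R]_n -> 'cV[R]_n) (etainv : 'cV[R]_n -> 'cV[R]_n)
  (f : 'cV[R]_n -> 'cV[R]_n) (B : 'cV[R]_n -> 'M[R]_(n, m))
  (J : 'cV[R]_n -> 'M[R]_n) :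
  (0 < n)%N ->
  (* setting *)
  C1scal H -> (forall z, 0 <= H z) -> is_gradient H eta ->
  (* property (P) *)
  (exists (p : nat) (l : 'cV[R]_n -> 'cV[R]_p),
     forall z, (eta z)^T *m f z = - ((l z)^T *m l z)) ->
  (* Standing Assumption *)
  C1 f -> C1 eta ->
  cancel eta etainv -> cancel etainv eta ->
  f (etainv 0) = 0 ->
  (forall z, jac eta z \in unitmx) ->
  (* f = J eta with J skewPart-symmetric *)
  (forall z, (J z)^T = - J z) ->
  (forall z, f z = J z *m eta z) ->
  (* 1. *)
  (exists P : 'cV[R]_n -> 'M[R]_n,
     forall z, P z *m eta z = 0 /\ symPart (Mmat f etainv eta z) + symPart (P z) = 0)
  /\
  (* 2. *)
  (forall z : 'cV[R]_n,
     eta z != 0 ->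
     (forall i : 'I_n, (0 < i)%N -> (i < n.-1)%N -> eta z i 0 != 0) ->
     (exists! P : 'M[R]_n,
        P *m eta z = 0 /\ symPart P = - symPart (Mmat f etainv eta z) /\ tridiagonal (skewPart P))
     /\
     (exists! p : 'cV[R]_(n.-1),
        Tmat (eta z) *m p = symPart (Mmat f etainv eta z) *m eta z)
     /\
     (forall (P : 'M[R]_n) (p : 'cV[R]_(n.-1)),
        P *m eta z = 0 -> symPart P = - symPart (Mmat f etainv eta z) -> tridiagonal (skewPart P) ->
        (superdiag_is (skewPart P) p <->
         Tmat (eta z) *m p = symPart (Mmat f etainv eta z) *m eta z))).
Proof.
move=> _ _ _ _ _ C1f C1eta etaK etainvK f0 ujac tJ fJ.
(* From this identity, linear algebra with v = eta z and A = M(z) gives both parts. *)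
have quad z := Mmat_quad_eq0 z C1f C1eta etaK etainvK ujac tJ fJ f0.
split.
  (* Part 1 asks for a map, so a completion is chosen at each z. *)
  exists (fun z => sval (cid (skew_completion (quad z)))) => z.
  exact: svalP (cid (skew_completion (quad z))).
move=> z z0 zint; split; first exact: tridiagonal_completion_unique.
by split=> [|P p]; [exact: Tmat_exists_unique|exact: superdiag_iff].
Qed.
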